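(* For every integer $n\ge 7$, $\mathrm{capt}(n)=n-4$. Moreover, for every $n\ge 9$, a cop-win graph on $n$ vertices is CT-maximal if and only if it belongs to $\mathcal{H}_7^{+}$. For $n\le 8$ the values of $\mathrm{capt}(n)$ and the CT-maximal graphs on $n$ vertices are as follows (here $P_m$ is the path on $m$ vertices and $K_3$ the triangle): $n=1$: $\mathrm{capt}=0$, CT-maximal graphs: $P_1$. $n=2$: $\mathrm{capt}=1$: $P_2$. $n=3$: $\mathrm{capt}=1$: $P_3$ and $K_3$. $n=4$: $\mathrm{capt}=2$: $P_4$. $n=5$: $\mathrm{capt}=2$: $P_5$ and the type-0 graphs realizing $(2,3)$ and $(3,2)$. $n=6$: $\mathrm{capt}=3$: $P_6$. $n=7$: $\mathrm{capt}=3$: $P_7$, $H_7$, and the type-0 graphs realizing $(2,2,3)$, $(2,3,2)$, $(3,2,2)$. $n=8$: $\mathrm{capt}=4$: $P_8$ and every graph in $\mathcal{H}_7^{+1}$.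
   Context: All graphs are finite, nonempty, and reflexive (every vertex has a loop, so each vertex is adjacent to itself). $N[v]$ denotes the closed neighborhood of $v$ (all vertices adjacent to $v$, including $v$). For distinct vertices $v,w$, $w$ strictly corners $v$ if $N[v]\subsetneq N[w]$; $v$ is then a strict corner. A vertex dominates a set if it is adjacent to every vertex of the set. Cops and robbers: a cop chooses a vertex, then the robber does; then they alternate moves, cop first, each move going to an adjacent vertex or staying. The cop wins if she occupies the robber's vertex. $G$ is cop-win if the cop can force a win; the capture time $\mathrm{capt}(G)$ of a cop-win graph is the minimum number of cop moves (not counting her initial placement) needed to guarantee capture. $\mathrm{capt}(n)$ is the maximum capture time over cop-win graphs on $n$ vertices, and a cop-win graph on $n$ vertices is CT-maximal if its capture time equals $\mathrm{capt}(n)$. Corner ranking: set $G^{(1)}=G$, $k=1$. If $G^{(k)}$ is a clique, give all its vertices rank $k$ and stop. Else if $G^{(k)}$ has no strict corners, give all its vertices rank $\infty$ and stop. Else give every strict corner of $G^{(k)}$ rank $k$, let $G^{(k+1)}$ be the induced subgraph of $G^{(k)}$ obtained by deleting them, increase $k$ by one and repeat. The corner rank of $G$ is the largest rank of a vertex. $X_k$ is the set of vertices of rank $k$. If $G$ has finite corner rank $\alpha\ge 2$, $G$ is of type 1 if some (equivalently every) vertex of rank $\alpha$ dominates $V(G^{(\alpha-1)})$, and of type 0 otherwise. (Known: $G$ is cop-win iff its corner rank is finite, and then a type-$r$ graph has capture time $\alpha-r$.) A vector is a finite list of positive integers. The rank cardinality vector of $G$ with corner rank $\alpha$ is $(x_\alpha,x_{\alpha-1},\dots,x_1)$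 with $x_k=|X_k|$. A vector is realizable (resp. $r$-realizable, $r\in\{0,1\}$) if it is the rank cardinality vector of some cop-win graph (resp. some cop-win graph of type $r$); that graph realizes (resp. $r$-realizes) it. $H_7$ is the graph on vertices $a_1,a_2,b_1,b_2,c_1,c_2,d$ with edges $a_1a_2,a_1b_1,a_1b_2,a_2b_1,a_2b_2,a_2c_1,a_1c_2,b_1c_1,b_1c_2,b_1d,b_2c_1,b_2c_2,c_1d,c_2d$. For $k\ge 0$, $\mathcal{H}_7^{+k}$ is the set of graphs realizing the vector $(2,2,2,1,\dots,1)$ of length $4+k$, and $\mathcal{H}_7^{+}=\bigcup_{k\ge 0}\mathcal{H}_7^{+k}$. *)

(* Defs.v *)
From mathcomp Require Import all_boot.
Set Implicit Arguments. Unset Strict Implicit. Unset Printing Implicit Defensive.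

Definition is_graph (T : finType) (e : rel T) : Prop :=
  (forall x, e x x) /\ (forall x y, e x y = e y x).

(* win e k c r : from the position where the cop is at c, the robber at r and
   the cop is to move, the cop can guarantee capture within k cop moves. *)
Fixpoint win (T : finType) (e : rel T) (k : nat) (c r : T) : bool :=
  if k is k'.+1 then
    (c == r) ||
    [exists c', e c c' &&
       ((c' == r) || [forall r', e r r' ==> win e k' c' r'])]
  else c == r.

Definition cop_wins_in (T : finType) (e : rel T) (k : nat) : bool :=
  [exists c, [forall r, win e k c r]].

Definition cop_win (T : finType) (e : rel T) : Prop := exists k, cop_wins_in e k.

Definition capture_time (T : finType) (e : rel T) (k : nat) : Prop :=
  cop_wins_in e k /\ forall j, j < k -> ~~ cop_wins_in e j.

Definition capt_is (n m : nat) : Prop :=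
  (exists (T : finType) (e : rel T), [/\ is_graph e, #|T| = n & capture_time e m])
  /\ (forall (T : finType) (e : rel T) (k : nat),
        is_graph e -> #|T| = n -> capture_time e k -> k <= m).

Definition CT_maximal (T : finType) (e : rel T) : Prop :=
  exists m, capt_is #|T| m /\ capture_time e m.

Section Corner.
Variables (T : finType) (e : rel T).

Definition nbhd (S : {set T}) (v : T) : {set T} := [set u in S | e v u].

Definition is_clique (S : {set T}) : bool :=
  [forall x in S, forall y in S, e x y].

Definition corners (S : {set T}) : {set T} :=
  [set v in S | [exists w in S, (w != v) && (nbhd S v \proper nbhd S w)]].

(* stage j = V(G^(j+1)) *)
Definition stage (j : nat) : {set T} :=
  iter j (fun S => S :\: corners S) setT.

(* G has finite corner rank j0+1 : G^(j0+1) is the first clique in the process *)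
Definition corner_rank_pred (j0 : nat) : Prop :=
  is_clique (stage j0) /\ (forall j, j < j0 -> ~~ is_clique (stage j)).

(* rank cardinality vector (x_alpha, ..., x_1) when alpha = j0 + 1 *)
Definition rcv (j0 : nat) : seq nat :=
  #|stage j0| :: [seq #|corners (stage j)| | j <- rev (iota 0 j0)].

(* type 1 (for alpha = j0+1 >= 2): some vertex of rank alpha (= of stage j0)
   dominates V(G^(alpha-1)) = stage (j0-1) *)
Definition type1 (j0 : nat) : bool :=
  [exists v in stage j0, [forall u in stage j0.-1, e v u]].
End Corner.

Definition realizes (T : finType) (e : rel T) (s : seq nat) : Prop :=
  exists j0, corner_rank_pred e j0 /\ s = rcv e j0.

Definition realizes0 (T : finType) (e : rel T) (s : seq nat) : Prop :=
  exists j0, [/\ corner_rank_pred e j0, s = rcv e j0, 1 <= j0 & ~~ type1 e j0].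

Definition in_H7plus_k (k : nat) (T : finType) (e : rel T) : Prop :=
  realizes e ([:: 2; 2; 2] ++ nseq k.+1 1).

Definition in_H7plus (T : finType) (e : rel T) : Prop :=
  exists k, in_H7plus_k k e.

Definition graph_iso (T1 T2 : finType) (e1 : rel T1) (e2 : rel T2) : Prop :=
  exists f : T1 -> T2, bijective f /\ forall x y, e2 (f x) (f y) = e1 x y.

Definition path_rel (m : nat) : rel 'I_m :=
  fun i j => (i <= j.+1) && (j <= i.+1).

Definition K3_rel : rel 'I_3 := fun _ _ => true.

(* H_7 with a1=0, a2=1, b1=2, b2=3, c1=4, c2=5, d=6 *)
Definition H7_edges : seq (nat * nat) :=
  [:: (0,1); (0,2); (0,3); (1,2); (1,3); (1,4); (0,5);
      (2,4); (2,5); (2,6); (3,4); (3,5); (4,6); (5,6)].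

Definition H7_rel : rel 'I_7 :=
  fun i j => [|| i == j, (val i, val j) \in H7_edges | (val j, val i) \in H7_edges].

Arguments path_rel m : clear implicits.

(* Main.v *)
Require Import Defs.
From mathcomp Require Import all_boot zify.
Set Implicit Arguments. Unset Strict Implicit. Unset Printing Implicit Defensive.

(* A cop on the robber's shadow (his image under the retractions that send each
   strict corner to a vertex of higher rank cornering it) can catch his shadow
   one stage lower at every move, while a robber who is not adjacent to the
   cop's shadow in some stage can stay so in the next lower stage; hence a graph
   of corner rank alpha >= 2 and type r has capture time alpha - r.  Since a
   graph on n vertices has n - alpha = sum (x_k - 1), a capture time of at least
   n - 4 leaves finitely many beginnings (x_alpha, x_(alpha-1), ...) of the rank
   cardinality vector.  Those that do not occur are excluded, and the graphs
   claimed to be unique are identified, by enumerating every graph with a given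
   such beginning, one rank at a time; beginnings suffice because deleting the
   vertices of rank 1 preserves the type and the other ranks. *)

(** * The capture time in terms of the corner ranking *)

Lemma winW (T : finType) (e : rel T) k c r : (forall x, e x x) ->
  win e k c r -> win e k.+1 c r.
Proof.
move=> erefl; elim: k c r => [|k IH] c r; first by move=> /eqP->; rewrite /= eqxx.
case/orP=> [/eqP->|/existsP[c' /andP[cc' H]]]; first by rewrite /= eqxx.
apply/orP; right; apply/existsP; exists c'; rewrite cc' /=.
case/orP: H => [->//|/forallP H]; apply/orP; right; apply/forallP => r'.
by apply/implyP=> /(implyP (H r'))/IH.
Qed.

Lemma cop_wins_in_leq (T : finType) (e : rel T) j k : (forall x, e x x) ->
  j <= k -> cop_wins_in e j -> cop_wins_in e k.
Proof.
move=> erefl /subnKC <-; elim: (k - j) => [|i IH]; first by rewrite addn0.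
rewrite addnS => /IH/existsP[c /forallP H]; apply/existsP; exists c.
by apply/forallP=> r; apply: winW.
Qed.

Lemma capture_time_uniq (T : finType) (e : rel T) j k :
  capture_time e j -> capture_time e k -> j = k.
Proof.
case=> wj Nj [wk Nk]; case: (ltngtP j k) => // [/Nk|/Nj]; first by rewrite wj.
by rewrite wk.
Qed.

Lemma capture_timeP (T : finType) (e : rel T) k : (forall x, e x x) ->
  cop_wins_in e k -> (if k is j.+1 then ~~ cop_wins_in e j else true) ->
  capture_time e k.
Proof.
move=> erefl wk Nk; split=> // j; case: k wk Nk => // k _ Nk; rewrite ltnS => jk.
by apply: contra Nk; apply: cop_wins_in_leq.
Qed.

Section Ranking.
Variables (T : finType) (e : rel T).
Hypotheses (e_refl : forall x, e x x) (e_sym : forall x y, e x y = e y x).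
Implicit Types (S : {set T}) (u v w x : T).

Local Notation nb := (nbhd e).
Local Notation core S := (S :\: corners e S).

Lemma nbhd_subP S v w :
  reflect (forall u, u \in S -> e v u -> e w u) (nb S v \subset nb S w).
Proof.
apply: (iffP subsetP) => H u; first by move=> uS vu; have := H u; rewrite !inE uS vu => /(_ isT).
by rewrite !inE => /andP[uS vu]; rewrite uS (H u).
Qed.

Lemma cornersP S v :
  reflect (v \in S /\ exists2 w, w \in S & nb S v \proper nb S w)
          (v \in corners e S).
Proof.
rewrite inE; apply: (iffP andP) => -[vS].
  by case/exists_inP=> w wS /andP[_ vw]; split=> //; exists w.
case=> w wS vw; split=> //; apply/exists_inP; exists w => //; rewrite vw andbT.
by apply: contraTneq vw => ->; rewrite properxx.
Qed.

(** Among the vertices of [S] whose neighborhood contains that of [v], one with the largest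
    neighborhood is no strict corner. *)
Lemma core_above S v : v \in S -> exists2 w, w \in core S & nb S v \subset nb S w.
Proof.
move=> vS; case: (arg_maxnP (P := fun w => (w \in S) && (nb S v \subset nb S w))
   (fun w => #|nb S w|) (i0 := v)); first by rewrite vS subxx.
move=> w /andP[wS vw] max; exists w => //; rewrite inE wS andbT.
apply/cornersP => -[_ [w' w'S ww']]; have := proper_card ww'.
rewrite ltnNge => /negP; apply; apply: max.
by rewrite w'S (subset_trans vw (proper_sub ww')).
Qed.

Lemma core_max S v w : v \in core S -> w \in S -> nb S v \subset nb S w ->
  nb S v = nb S w.
Proof.
rewrite inE => /andP[Nv vS] wS vw; apply/eqP; rewrite eqEproper vw /=.
by apply: contra Nv => H; apply/cornersP; split=> //; exists w.
Qed.

Lemma stage_subset i j : i <= j -> stage e j \subset stage e i.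
Proof.
move=> /subnKC <-; elim: (j - i) => [|k IH]; first by rewrite addn0.
by rewrite addnS; apply: subset_trans IH; apply: subsetDl.
Qed.

Lemma stage_neq0 j : T -> stage e j != set0.
Proof.
move=> x0; elim: j => [|j /set0Pn[v vS]]; first by apply/set0Pn; exists x0; rewrite inE.
by have [w wS _] := core_above vS; apply/set0Pn; exists w.
Qed.

Lemma dominating_core S v : v \in S -> (forall u, u \in S -> e v u) -> v \in core S.
Proof.
move=> vS vD; rewrite inE vS andbT; apply/cornersP => -[_ [w _ /properP[_ [u]]]].
by rewrite !inE => /andP[uS _]; rewrite uS vD.
Qed.

(** All neighborhoods in [S] lie in that of [v], and for a survivor of the deletion the inclusion is
    an equality. Hence some and every agree in the definition of type 1. *)
Lemma dominating_core_dominates S v x : v \in S -> (forall u, u \in S -> e v u) ->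
  x \in core S -> forall u, u \in S -> e x u.
Proof.
move=> vS vD xS u uS; have : u \in nb S v by rewrite inE uS vD.
rewrite -(core_max xS vS); first by rewrite inE => /andP[].
by apply/nbhd_subP => y yS _; apply: vD.
Qed.

Lemma is_cliqueP S : reflect {in S &, forall x y, e x y} (is_clique e S).
Proof.
apply: (iffP forall_inP) => H x; last by move=> xS; apply/forall_inP=> y; apply: H.
by move=> y xS yS; apply: (forall_inP (H x xS)).
Qed.

(* By [core_above] the default of [odflt] is never used. *)
Fixpoint shadow j v : T :=
  if j is i.+1 then
    odflt v [pick w in stage e j | nb (stage e i) (shadow i v) \subset nb (stage e i) w]
  else v.

Lemma shadowP j v : shadow j v \in stage e j /\
  nb (stage e j) (shadow j v) \subset nb (stage e j) (shadow j.+1 v).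
Proof.
have step i : shadow i v \in stage e i -> shadow i.+1 v \in stage e i.+1 /\
    nb (stage e i) (shadow i v) \subset nb (stage e i) (shadow i.+1 v).
  move=> vi; rewrite [shadow i.+1 v]/=; case: pickP => [w /andP[]//|H].
  by have [w wS vw] := core_above vi; have := H w; rewrite vw andbT => /negP[].
suff vj : shadow j v \in stage e j by split=> //; apply: (step j vj).2.
elim: j => [|j /step[]//]; by rewrite inE.
Qed.

Lemma shadow_stage j v : shadow j v \in stage e j.
Proof. by case: (shadowP j v). Qed.

Lemma shadow_sub j v u : u \in stage e j -> e (shadow j v) u -> e (shadow j.+1 v) u.
Proof. by case: (shadowP j v) => _ /nbhd_subP; apply. Qed.

Lemma shadow_nbhd j v u : u \in stage e j -> e v u -> e (shadow j v) u.
Proof.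
elim: j => // j IH uS vu; have uSj := subsetP (stage_subset (leqnSn j)) u uS.
by apply: shadow_sub => //; apply: IH.
Qed.

(** The two ends can be moved to the next stage one after the other, since each move only enlarges a
    neighborhood in the current stage. *)
Lemma shadow_adj j u v : e u v -> e (shadow j u) (shadow j v).
Proof.
move=> uv; elim: j => // j IH; apply: shadow_sub; last first.
  by rewrite e_sym; apply: shadow_sub; rewrite ?shadow_stage // e_sym.
by apply: (subsetP (stage_subset (leqnSn j))); apply: shadow_stage.
Qed.

(* Once the cop sits on the robber's shadow in some stage, each further move
   lets her catch his shadow one stage lower. *)
Lemma chase j c r : e c (shadow j r) -> win e j.+1 c r.
Proof.
elim: j c r => [|j IH] c r cr; apply/orP; right; apply/existsP.
  by exists r; rewrite cr eqxx.
exists (shadow j.+1 r); rewrite cr; apply/orP; right; apply/forallP => r'.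
apply/implyP=> rr'; apply: IH; apply: shadow_sub; rewrite ?shadow_stage //.
exact: shadow_adj.
Qed.

Lemma cop_wins_dominated j c : (forall u, u \in stage e j -> e c u) ->
  cop_wins_in e j.+1.
Proof.
move=> H; apply/existsP; exists c; apply/forallP=> r; apply: chase.
by apply: H; apply: shadow_stage.
Qed.

(* Vertices of stage j are not strict corners of stage j-1, so a robber there
   who is not adjacent to the cop's shadow can leave her next shadow's
   neighborhood inside stage j-1. *)
Lemma evade j c r : r \in stage e j -> ~~ e (shadow j c) r -> ~~ win e j.+1 c r.
Proof.
elim: j c r => [|j IH] c r rS Ncr.
  rewrite /= negb_or; apply/andP; split; first by apply: contraNneq Ncr => ->.
  apply/existsP => -[c' /andP[cc' /orP[/eqP Ec|/forallP/(_ r)]]].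
    by rewrite -Ec cc' in Ncr.
  by rewrite e_refl /= => /eqP Ec; rewrite -Ec cc' in Ncr.
have rSj : r \in stage e j by apply: (subsetP (stage_subset (leqnSn j))).
have Ncr' : ~~ e (shadow j c) r by apply: contra Ncr; apply: shadow_sub.
have Ncr0 c' : e c c' -> c' != r.
  by move=> cc'; apply: contraNneq Ncr => Ec; apply: shadow_nbhd; rewrite -?Ec // Ec.
rewrite [win _ _ _ _]/= negb_or Ncr0 //=; apply/existsP => -[c' /andP[cc']].
rewrite (negbTE (Ncr0 _ cc')) /= => /forallP H.
(* Without such an exit the two neighborhoods would be equal, as [r] is no strict corner of stage
   [j]; but the old shadow is adjacent to the new one and not to [r]. *)
have /subsetPn[r'] : ~~ (nb (stage e j) r \subset nb (stage e j) (shadow j c')).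
  apply: contra Ncr' => sub; rewrite e_sym.
  have : shadow j c \in nb (stage e j) (shadow j c').
    by rewrite inE shadow_stage shadow_adj // e_sym.
  by rewrite -(core_max rS (shadow_stage j c') sub) inE => /andP[].
rewrite !inE => /andP[r'S rr']; rewrite r'S /= => Nr'.
by move/negP: (IH c' r' r'S Nr'); apply; apply: (implyP (H r') rr').
Qed.

Lemma not_cop_wins_undominated j :
  (forall v, v \in stage e j -> exists2 u, u \in stage e j & ~~ e v u) ->
  ~~ cop_wins_in e j.+1.
Proof.
move=> H; apply/existsP=> -[c /forallP wc].
have [r rS Nr] := H _ (shadow_stage j c).
by have := evade rS Nr; rewrite wc.
Qed.

Lemma dominated_clique_core S v : v \in S -> (forall u, u \in S -> e v u) ->
  is_clique e (core S).
Proof.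
move=> vS vD; apply/is_cliqueP => x y xS yS.
apply: (dominating_core_dominates vS vD xS); by move: yS; rewrite inE => /andP[].
Qed.

Lemma not_dominatingP S v : reflect (exists2 u, u \in S & ~~ e v u)
  (~~ [forall u in S, e v u]).
Proof. by rewrite negb_forall_in; apply: exists_inP. Qed.

(** By [dominated_clique_core], if stage [k.+1] is no clique then no vertex dominates stage [k], and
    the robber survives [k.+1] moves. *)
Lemma clique_of_cop_wins k : cop_wins_in e k.+1 -> is_clique e (stage e k.+1).
Proof.
apply: contraTT => Nc; apply: not_cop_wins_undominated => v vS.
apply/not_dominatingP; apply: contra Nc => /forall_inP; exact: dominated_clique_core.
Qed.

Lemma cop_win_rank : cop_win e -> exists j0, corner_rank_pred e j0.
Proof.
case=> k /(@cop_wins_in_leq _ _ _ k.+1 e_refl (leqnSn k))/clique_of_cop_wins ck.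
have ex : exists j, is_clique e (stage e j) by exists k.+1.
exists (ex_minn ex); case: ex_minnP => j cj min; split=> // i.
by rewrite ltnNge; apply: contra; apply: min.
Qed.

Lemma capture_time_clique : T -> corner_rank_pred e 0 ->
  capture_time e (1 < #|T|).
Proof.
move=> x0 [/is_cliqueP cl _]; have {}cl x y : e x y by apply: cl; rewrite inE.
apply: capture_timeP => //; case: ltnP => [lt1|le1].
- by apply: (@cop_wins_dominated 0 x0).
- by apply/existsP; exists x0; apply/forallP=> r; apply/eqP; exact: (fintype_le1P le1).
- apply/existsP=> -[c /forallP H]; suff : #|T| <= 1 by rewrite leqNgt lt1.
  by apply/fintype_le1P=> x y; rewrite -(eqP (H x) : c = x) -(eqP (H y) : c = y).
- by [].
Qed.

(** In type 1 the cop starts at a vertex dominating stage [j0], in type 0 at a vertex of the top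
    clique. One move less would make an earlier stage a clique in type 1, and would need a vertex
    dominating stage [j0] in type 0; such a vertex survives to the top and makes the type 1. *)
Lemma capture_time_rank j0 : T -> corner_rank_pred e j0.+1 ->
  capture_time e (j0.+2 - type1 e j0.+1).
Proof.
move=> x0 [cl Ncl]; apply: capture_timeP => //; case: (boolP (type1 _ _)) => t1.
- by case/exists_inP: t1 => v _ /forall_inP; apply: cop_wins_dominated.
- have /set0Pn[v vS] := stage_neq0 j0.+1 x0.
  by apply: (@cop_wins_dominated _ v) => u uS; apply: (is_cliqueP _ cl).
(* For [j0 = 0] no move is left, and winning then means that there is only one vertex. *)
- rewrite subn1 /=; case: j0 cl Ncl {t1} => [|j0] cl Ncl.
    apply/existsP=> -[c /forallP H]; have /negP := Ncl 0 isT; apply; apply/is_cliqueP.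
    by move=> x y _ _; rewrite -(eqP (H x)) (eqP (H y)).
  by apply: contra (Ncl j0.+1 _) => //; apply: clique_of_cop_wins.
rewrite subn0 /=; apply: not_cop_wins_undominated => v vS; apply/not_dominatingP.
apply: contra t1 => /forall_inP vD; apply/exists_inP; exists v; last by apply/forall_inP.
by apply: dominating_core.
Qed.
End Ranking.

(** * Rank cardinality vectors *)

Section RankVector.
Variables (T : finType) (e : rel T).
Hypotheses (e_refl : forall x, e x x) (e_sym : forall x y, e x y = e y x).
Implicit Types (S : {set T}).
Local Notation nb := (nbhd e).
Local Notation core S := (S :\: corners e S).

Lemma rcvS j : rcv e j.+1 = #|stage e j.+1| :: #|corners e (stage e j)| :: behead (rcv e j).
Proof. by rewrite /rcv -addn1 iotaD rev_cat /= !add0n addn1. Qed.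

Lemma size_rcv j : size (rcv e j) = j.+1.
Proof. by rewrite /= size_map size_rev size_iota. Qed.

Lemma corners_subset S : corners e S \subset S.
Proof. by apply/subsetP=> v /cornersP[]. Qed.

Lemma sumn_rcv j : sumn (rcv e j) = #|T|.
Proof.
elim: j => [|j IH]; first by rewrite /= cardsT addn0.
rewrite rcvS -{}IH /= addnA cardsD; congr (_ + _).
by rewrite (setIidPr (corners_subset _)) subnK // subset_leq_card ?corners_subset.
Qed.

(** Without strict corners the stages would no longer change, and stage [j0] would not be a
    clique. *)
Lemma corners_neq0 j0 j : corner_rank_pred e j0 -> j < j0 ->
  corners e (stage e j) != set0.
Proof.
case=> cl Ncl jj0; apply: contra (Ncl _ jj0) => /eqP c0.
suff E k : stage e (j + k) = stage e j by rewrite -(E (j0 - j)) subnKC // ltnW.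
elim: k => [|k IH]; first by rewrite addn0.
by rewrite addnS [LHS]/= IH c0 setD0.
Qed.

Lemma rcv_gt0 j0 : T -> corner_rank_pred e j0 -> all (leq 1) (rcv e j0).
Proof.
move=> x0 rk; rewrite /= card_gt0 stage_neq0 //=; apply/allP => c /mapP[j].
by rewrite mem_rev mem_iota => /= jj0 ->; rewrite card_gt0 (corners_neq0 rk).
Qed.

(** A single top vertex lies above every vertex of the preceding stage and so dominates it. *)
Lemma top_gt1 j0 : T -> ~~ type1 e j0.+1 -> 1 < #|stage e j0.+1|.
Proof.
move=> x0; apply: contraR; rewrite -leqNgt => le1.
have /set0Pn[v vS] := stage_neq0 e j0.+1 x0.
apply/exists_inP; exists v => //; apply/forall_inP => u uS.
have [w wS /nbhd_subP uw] := core_above e uS.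
by rewrite (card_le1_eqP le1 w v wS vS) uw.
Qed.

(** Unless [d] tells [x] and [a] apart in this way, restoring it keeps the inclusion of
    neighborhoods, which is then an equality because [x] is no strict corner of [S]. *)
Lemma single_corner_adj S d x a : corners e S = [set d] ->
  x \in core S -> a \in core S -> nb (core S) x \proper nb (core S) a ->
  e d x && ~~ e d a.
Proof.
move=> Sd xS aS pr; apply: contraLR (pr); rewrite negb_and negbK => /orP da.
suff E : nb S x = nb S a.
  suff -> : nb (core S) x = nb (core S) a by rewrite properxx.
  apply/setP=> u; have /setP/(_ u) := E; rewrite !inE.
  by case: (u \in S); rewrite ?andbF //= => ->.
have aS' : a \in S by move: aS; rewrite inE => /andP[].
apply: core_max => //; apply/nbhd_subP => u uS; case: (eqVneq u d) => [->|ud].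
  by case: da; rewrite ![e _ d]e_sym // => /negbTE->.
by apply: (nbhd_subP _ _ _ _ (proper_sub pr)); rewrite inE Sd inE ud.
Qed.

(** The vertex above a single corner [d] would dominate [S], hence so would the whole core, and [S]
    would be a clique. *)
Lemma two_corners S : is_clique e (core S) -> ~~ is_clique e S -> #|corners e S| != 1.
Proof.
move=> /is_cliqueP cl; apply: contraNneq => /eqP/cards1P[d Sd].
have dS : d \in S by move/setP: Sd => /(_ d); rewrite !inE eqxx => /andP[].
have [w wC /nbhd_subP dw] := core_above e dS.
have mem x : x \in S -> x = d \/ x \in core S.
  by rewrite inE Sd inE => ->; case: eqP; [left|right].
have wS : w \in S by move: wC; rewrite inE => /andP[].
have wD u : u \in S -> e w u.
  by move=> uS; case: (mem u uS) => [->|uC]; [apply: dw|apply: cl].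
have D := dominating_core_dominates wS wD.
apply/is_cliqueP => x y xS yS; case: (mem x xS) => [->|xC]; last exact: D.
by case: (mem y yS) => [->//|yC]; rewrite e_sym; apply: D.
Qed.

(** A single corner [d] would be adjacent to every corner of the core, and so would the vertex [w]
    above it. It follows that [w] dominates the core, which is impossible whether or not [w] is a
    corner of it. *)
Lemma two_corners_below S : is_clique e (core (core S)) -> ~~ is_clique e (core S) ->
  #|corners e S| != 1.
Proof.
set C := core S => cl Ncl; apply/eqP => /eqP/cards1P[d Sd].
have memC x : x \in C -> x \in S by rewrite inE => /andP[].
have memcC x : x \in corners e C -> x \in C := subsetP (corners_subset C) x.
have memD x : x \in core C -> x \in C by rewrite inE => /andP[].
have dS : d \in S by move/setP: Sd => /(_ d); rewrite !inE eqxx => /andP[].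
have [w wC /nbhd_subP dw] := core_above e dS.
have dc x : x \in corners e C -> e d x.
  case/cornersP=> xC [a aC xa]; by have /andP[] := single_corner_adj Sd xC aC xa.
have wc x : x \in corners e C -> e w x.
  by move=> xc; apply: dw; [apply/memC/memcC|apply: dc].
have split x : x \in C -> x \in corners e C \/ x \in core C.
  by move=> xC; rewrite in_setD xC andbT; case: (x \in corners e C); [left|right].
have clD := is_cliqueP _ _ cl.
case: (split w wC) => [wcC|wD].
- have /cornersP[_ [a0 a0C wa0]] := wcC.
  have [a aD a0a] := core_above e a0C.
  have wa := proper_sub_trans wa0 a0a.
  have aDom u : u \in C -> e a u.
    move=> uC; case: (split u uC) => [uc|uD]; last exact: clD.
    by apply: (nbhd_subP _ _ _ _ (proper_sub wa)) => //; apply: wc.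
  suff : w \in core C by rewrite inE wcC.
  apply: dominating_core => // u uC; case: (split u uC) => [|uD]; first exact: wc.
  by rewrite e_sym; apply: (dominating_core_dominates (memD a aD) aDom).
(* Here [w] strictly corners every corner of [C], so [d] is not adjacent to [w], although [w] lies
   above [d]. *)
- have wDom u : u \in C -> e w u.
    by move=> uC; case: (split u uC) => [|uD]; [apply: wc|apply: clD].
  have /set0Pn[x xc] : corners e C != set0.
    by apply: contraNneq Ncl => c0; move: cl; rewrite c0 setD0.
  suff pr : nb C x \proper nb C w.
    by have := single_corner_adj Sd (memcC x xc) wC pr; rewrite [e d w]e_sym dw // andbF.
  have /cornersP[_ [b _ xb]] := xc; apply: proper_sub_trans xb _.
  by apply/nbhd_subP => u uC _; apply: wDom.
Qed.
End RankVector.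

(** * Enumeration of the graphs with a given rank cardinality vector *)

(* Graphs on initial segments of nat, as lists of rows: row i lists the
   adjacencies of vertex i with the vertices below i. *)
Definition adj (g : seq bitseq) (i j : nat) : bool :=
  nth (nth (eqn i j) (nth [::] g j) i) (nth [::] g i) j.

(** Conditionals replace the boolean connectives, whose arguments [vm_compute] would always
    evaluate. *)
Definition adj_corner (f : nat -> nat -> bool) (l : seq nat) (i : nat) : bool :=
  has (fun w => if all (fun k => if f i k then f w k else true) l
                then has (fun k => if f w k then ~~ f i k else false) l
                else false) l.

Fixpoint bitseqs (n : nat) : seq bitseq :=
  if n is n'.+1 then
    let r := bitseqs n' in map (cons true) r ++ map (cons false) r
  else [:: [::]].

(* A new corner is cornered by some old vertex w, so its old neighbors lie in
   the closed neighborhood of w. *)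
Definition corner_rows (g : seq bitseq) : seq bitseq :=
  [seq r <- bitseqs (size g) |
    has (fun w => if nth false r w then
                    all (fun k => if nth false r k then adj g w k else true)
                        (iota 0 (size g))
                  else false) (iota 0 (size g))].

(** Here [y] new vertices are present and [x] are to come. A row consists of adjacencies [r] to the
    old vertices and arbitrary ones [q] to the earlier new vertices. *)
Fixpoint add_rows (rows : seq bitseq) (y x : nat) (g : seq bitseq) : seq (seq bitseq) :=
  if x is x'.+1 then
    flatten [seq add_rows rows y.+1 x' (rcons g (r ++ q)) | r <- rows, q <- bitseqs y]
  else [:: g].

(** The filter makes the new vertices exactly the strict corners, so that one round of the ranking
    gives back [g]. *)
Definition add_layer (x : nat) (g : seq bitseq) : seq (seq bitseq) :=
  [seq h <- add_rows (corner_rows g) 0 x g |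
    all (fun i => adj_corner (adj h) (iota 0 (size h)) i == (size g <= i)) (iota 0 (size h))].

Definition adj_type1 (a : nat) (g : seq bitseq) : bool :=
  has (fun i => all (adj g i) (iota 0 (size g))) (iota 0 a).

Definition clique_rows (a : nat) : seq bitseq := mkseq (nseq^~ true) a.

Fixpoint add_layers (v : seq nat) (gs : seq (seq bitseq)) : seq (seq bitseq) :=
  if v is x :: v' then add_layers v' (flatten (map (add_layer x) gs)) else gs.

(* The vertices are numbered by decreasing rank; the type t is ignored when v has
   a single entry. *)
Definition realizations (t : bool) (v : seq nat) : seq (seq bitseq) :=
  match v with
  | [::] => [::]
  | [:: a] => [:: clique_rows a]
  | a :: b :: v' =>
      add_layers v' [seq g <- add_layer b (clique_rows a) | adj_type1 a g == t]
  end.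

Definition isomorphic_via (f : nat -> nat -> bool) (n : nat) (g : seq bitseq) (p : seq nat) :=
  [&& size p == n, uniq p, all (gtn n) p &
    all (fun i => all (fun j => adj g (nth 0 p i) (nth 0 p j) == f i j) (iota 0 n))
      (iota 0 n)].

(** * Completeness of the enumeration *)

Lemma mem_bitseqs (r : bitseq) n : size r = n -> r \in bitseqs n.
Proof.
elim: r n => [|b r IH] [|n] //= [/IH rn]; rewrite mem_cat.
by apply/orP; case: b; [left|right]; apply: map_f.
Qed.

Lemma add_layers_rcons v x gs :
  add_layers (rcons v x) gs = flatten (map (add_layer x) (add_layers v gs)).
Proof. by elim: v gs => //= y v IH gs; apply: IH. Qed.

Lemma realizations_rcons t v x : 1 < size v ->
  realizations t (rcons v x) = flatten (map (add_layer x) (realizations t v)).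
Proof. by case: v => [|a [|b v]] //= _; apply: add_layers_rcons. Qed.

Lemma adj_cornerP (T : finType) (e : rel T) f (h : nat -> T) (S : {set T}) l i :
  (forall u, reflect (exists2 k, k \in l & u = h k) (u \in S)) ->
  {in l &, forall i j, f i j = e (h i) (h j)} ->
  i \in l -> adj_corner f l i = (h i \in corners e S).
Proof.
move=> lS fE li; have hS k : k \in l -> h k \in S by move=> lk; apply/lS; exists k.
apply/hasP/cornersP => [[w lw]|[_ [w /lS[k lk ->]]]].
  case: allP => // sub /hasP[k lk]; case wk: (f w k) => // Nik; split; first exact: hS.
  exists (h w); first exact: hS.
  apply/properP; split; last by exists (h k); rewrite inE hS -?fE.
  apply/nbhd_subP=> u /lS[m lm ->]; rewrite -!fE // => im.
  by have := sub m lm; rewrite im.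
case/properP=> /nbhd_subP sub [u]; rewrite !inE => /andP[uS] + /nandP[|]; first by rewrite uS.
case/lS: uS => m lm ->; rewrite -!fE // => km Nim.
exists k => //; case: allP => [_|[]]; first by apply/hasP; exists m; rewrite // km.
move=> p lp; case ip: (f i p) => //.
by rewrite fE //; apply: sub; rewrite ?hS -?fE.
Qed.

Section Encoding.
Variables (T : finType) (e : rel T) (x0 : T).
Hypotheses (e_refl : forall x, e x x) (e_sym : forall x y, e x y = e y x).
Implicit Types (S : {set T}) (s t : seq T).
Local Notation core S := (S :\: corners e S).

Definition enc s : seq bitseq :=
  mkseq (fun i => map (e (nth x0 s i)) (take i s)) (size s).

Lemma size_enc s : size (enc s) = size s.
Proof. by rewrite size_mkseq. Qed.

Lemma enc_rcons s v : enc (rcons s v) = rcons (enc s) (map (e v) s).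
Proof.
rewrite /enc size_rcons /mkseq -addn1 iotaD map_cat cats1 /= add0n.
rewrite nth_rcons ltnn eqxx -[rcons s v]cats1 take_size_cat //; congr rcons.
apply/eq_in_map => i; rewrite mem_iota => /= lt; rewrite nth_cat lt.
by rewrite takel_cat // ltnW.
Qed.

Lemma nth_enc s i : i < size s -> nth [::] (enc s) i = map (e (nth x0 s i)) (take i s).
Proof. by move=> lt; rewrite nth_mkseq. Qed.

Lemma adj_enc s i j : i < size s -> j < size s ->
  adj (enc s) i j = e (nth x0 s i) (nth x0 s j).
Proof.
(* For [i < j] the row of [i] is too short and its default reads the row of [j]; for [i = j] both
   are too short and the innermost default gives the loop. *)
move=> lti ltj; rewrite /adj !nth_enc //; case: (ltngtP i j) => ij.
- rewrite [LHS]nth_default ?size_map ?size_takel ?(ltnW lti) ?(ltnW ij) //.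
  by rewrite (nth_map x0) ?size_takel ?(ltnW ltj) // nth_take // e_sym.
- by rewrite (nth_map x0) ?size_takel ?(ltnW lti) // nth_take.
- rewrite ij nth_default ?size_map ?size_takel ?(ltnW ltj) //.
  by rewrite nth_default ?size_map ?size_takel ?(ltnW ltj) // e_refl -[eqn j j]/(j == j) eqxx.
Qed.

Lemma corner_rows_complete S s v : s =i core S -> v \in corners e S ->
  map (e v) s \in corner_rows (enc s).
Proof.
move=> sS /(subsetP (corners_subset _ _)) vS.
have [w] := core_above e vS; rewrite -sS => /(nthP x0)[i lti <-] /nbhd_subP vw.
rewrite mem_filter size_enc mem_bitseqs ?size_map // andbT.
apply/hasP; exists i; rewrite ?mem_iota // (nth_map x0) //.
rewrite e_sym vw //; apply/allP => k; rewrite mem_iota /= => ltk.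
rewrite (nth_map x0) // adj_enc //; case vk: (e v _) => //; apply: vw => //.
have : nth x0 s k \in core S by rewrite -sS mem_nth.
by rewrite inE => /andP[].
Qed.

(** The part [s'] of the layer that is already added makes the induction on [t] go through. *)
Lemma add_rows_complete rows s s' t :
  (forall v, v \in t -> map (e v) s \in rows) ->
  enc (s ++ s' ++ t) \in add_rows rows (size s') (size t) (enc (s ++ s')).
Proof.
elim: t s' => [|v t IH] s' H /=; first by rewrite cats0 mem_seq1.
apply/flattenP; exists (add_rows rows (size s').+1 (size t)
    (rcons (enc (s ++ s')) (map (e v) s ++ map (e v) s'))).
  apply/allpairsP; exists (map (e v) s, map (e v) s'); split=> //=.
    by apply: H; rewrite mem_head.
  by apply: mem_bitseqs; rewrite size_map.
rewrite /= -map_cat -enc_rcons rcons_cat -(size_rcons s' v) -cat_rcons.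
by apply: IH => u ut; apply: H; rewrite inE ut orbT.
Qed.

Lemma cat_core S s t : s =i core S -> t =i corners e S -> s ++ t =i S.
Proof.
move=> sS tS u; rewrite mem_cat sS tS inE.
case: (boolP (u \in corners e S)) => [/(subsetP (corners_subset _ _))->//|_].
by rewrite orbF.
Qed.

Lemma add_layer_complete S s t : s =i core S -> t =i corners e S ->
  enc (s ++ t) \in add_layer (size t) (enc s).
Proof.
move=> sS tS; rewrite mem_filter; apply/andP; split; last first.
  have := @add_rows_complete (corner_rows (enc s)) s [::] t; rewrite cats0; apply.
  by move=> v; rewrite tS; apply: corner_rows_complete.
have stS := cat_core sS tS.
apply/allP=> i; rewrite mem_iota !size_enc => /= lti; apply/eqP.
rewrite (@adj_cornerP _ e _ (nth x0 (s ++ t)) S) ?mem_iota //; first last.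
- by move=> k k'; rewrite !mem_iota; apply: adj_enc.
- move=> u; rewrite -stS; apply: (iffP (nthP x0)) => -[k].
    by move=> ltk <-; exists k; rewrite ?mem_iota.
  by rewrite mem_iota => ltk ->; exists k.
rewrite nth_cat; case: ltnP => si.
  have : nth x0 s i \in core S by rewrite -sS mem_nth.
  by rewrite inE => /andP[/negbTE->].
by rewrite -tS mem_nth // ltn_subLR // -size_cat.
Qed.

Lemma nth_rcv j0 k : k < j0 ->
  nth 0 (rcv e j0) k.+1 = #|corners e (stage e (j0 - k.+1))|.
Proof.
move=> lt; rewrite /= (nth_map 0) ?size_rev ?size_iota // nth_rev ?size_iota //.
by rewrite nth_iota // ltn_subrL (leq_ltn_trans _ lt).
Qed.

Lemma enc_clique S s : is_clique e S -> s =i S -> enc s = clique_rows (size s).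
Proof.
move=> /is_cliqueP cl sS; apply: (@eq_from_nth _ [::]); rewrite !size_mkseq // => i lti.
rewrite nth_enc // nth_mkseq //; apply: (@eq_from_nth _ false).
  by rewrite size_map size_nseq size_takel // ltnW.
move=> j; rewrite size_map size_takel ?(ltnW lti) // => ltj.
rewrite nth_nseq ltj (nth_map x0) ?size_takel ?(ltnW lti) // nth_take //.
by rewrite cl // -sS mem_nth // (ltn_trans ltj).
Qed.

Lemma adj_type1P s t S : s =i core S -> t =i corners e S ->
  adj_type1 (size s) (enc (s ++ t)) = [exists v in core S, [forall u in S, e v u]].
Proof.
move=> sS tS; have stS := cat_core sS tS; rewrite /adj_type1 size_enc.
have lt i : i < size s -> i < size (s ++ t) by rewrite size_cat => /ltn_addr->.
apply/hasP/exists_inP => [[i]|[v]].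
  rewrite mem_iota => /= lti /allP H; exists (nth x0 s i); first by rewrite -sS mem_nth.
  apply/forall_inP => u; rewrite -stS => /(nthP x0)[k ltk <-].
  have := H k; rewrite mem_iota adj_enc ?(lt i) // [nth _ _ i]nth_cat lti ltk; exact.
rewrite -sS => /(nthP x0)[i lti <-] /forall_inP H; exists i; first by rewrite mem_iota.
apply/allP=> k; rewrite mem_iota /= => ltk; rewrite adj_enc ?(lt i) //.
by rewrite [nth _ _ i]nth_cat lti; apply: H; rewrite -stS mem_nth.
Qed.

(** The list [s] grows from the top rank downwards, each step appending the corners of the next
    larger stage. All prefixes are covered, so that one impossible beginning excludes every vector
    that continues it. *)
Lemma realizations_complete j0 k : corner_rank_pred e j0 -> k <= j0 ->
  exists s, [/\ uniq s, s =i stage e (j0 - k) &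
    enc s \in realizations (type1 e j0) (take k.+1 (rcv e j0))].
Proof.
move=> [cl _]; elim: k => [|k IH] kj.
  exists (enum (stage e j0)); rewrite subn0 enum_uniq; split=> //.
    by move=> u; rewrite mem_enum.
  by rewrite /= take0 (enc_clique cl) ?mem_seq1 -?cardE // => u; rewrite mem_enum.
have [s [us sS Hs]] := IH (ltnW kj).
set S := stage e (j0 - k.+1).
have ES : stage e (j0 - k) = core S by rewrite -(subnSK kj).
rewrite ES in sS.
have tS : enum (corners e S) =i corners e S by move=> u; rewrite mem_enum.
have := add_layer_complete sS tS.
set t := enum _ in tS *; have szt : size t = #|corners e S| by rewrite -cardE.
move=> Hst; exists (s ++ t); split.
- rewrite cat_uniq us enum_uniq andbT /=; apply/hasPn => u; rewrite /= tS sS in_setD => ->.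
  by [].
- exact: cat_core.
rewrite (take_nth 0) ?size_rcv // nth_rcv // -szt.
(* The second layer is where the enumeration selects the type; later layers are only appended. *)
case: k kj IH Hs @S ES @t sS tS szt Hst => [|k] kj IH Hs S ES t sS tS szt Hst.
  have sz : size s = #|stage e j0|.
    by rewrite -(card_uniqP us); apply: eq_card => u; rewrite sS -ES subn0.
  rewrite /= take0 /= mem_filter; move: Hs; rewrite /= take0 /= mem_seq1 => /eqP <-.
  by rewrite Hst andbT -sz (adj_type1P sS tS) -ES subn0 /type1 /S subn1 eqxx.
rewrite realizations_rcons; last by rewrite size_takel ?size_rcv // ltnW.
by apply/flattenP; exists (add_layer (size t) (enc s)) => //; apply: map_f.
Qed.

Lemma graph_iso_enc s n (f : nat -> nat -> bool) (e2 : rel 'I_n) p :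
  uniq s -> s =i [set: T] -> #|T| = n -> (forall i j : 'I_n, e2 i j = f i j) ->
  isomorphic_via f n (enc s) p -> graph_iso e e2.
Proof.
move=> us sT cT e2f /and4P[/eqP szp up /allP pn /allP H].
have szs : size s = n by rewrite -(card_uniqP us) -cT -cardsT; apply: eq_card.
have pi (i : 'I_n) : nth 0 p i < size s by rewrite szs; apply: pn; rewrite mem_nth ?szp.
pose k (i : 'I_n) := nth x0 s (nth 0 p i).
have kinj : injective k.
  move=> i j /eqP; rewrite nth_uniq // nth_uniq ?szp // => /eqP; exact: val_inj.
have [|h kh hk] := inj_card_bij kinj; first by rewrite cT card_ord.
exists h; split=> [|x y]; first by exists k.
rewrite -{2}(hk x) -{2}(hk y) e2f /k -adj_enc //.
have mem (i : 'I_n) : val i \in iota 0 n by rewrite mem_iota /= add0n.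
by apply/esym/eqP; apply: (allP (H _ (mem (h x))) _ (mem (h y))).
Qed.
End Encoding.

(** * Graphs on initial segments of the natural numbers *)

Section Isomorphism.
Variables (T1 T2 : finType) (e1 : rel T1) (e2 : rel T2) (f : T1 -> T2).
Hypotheses (f_bij : bijective f) (f_mor : forall x y, e2 (f x) (f y) = e1 x y).

Lemma forall_bij (P : pred T2) : [forall y, P y] = [forall x, P (f x)].
Proof.
case: f_bij => g fg gf; apply/forallP/forallP => H x //.
by rewrite -(gf x).
Qed.

Lemma exists_bij (P : pred T2) : [exists y, P y] = [exists x, P (f x)].
Proof. by apply: negb_inj; rewrite !negb_exists; apply: forall_bij. Qed.

Lemma win_bij k c r : win e2 k (f c) (f r) = win e1 k c r.
Proof.
elim: k c r => [|k IH] c r /=; first by rewrite (bij_eq f_bij).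
rewrite (bij_eq f_bij) exists_bij; congr (_ || _); apply: eq_existsb => c'.
rewrite f_mor (bij_eq f_bij) forall_bij; congr (_ && (_ || _)).
by apply: eq_forallb => r'; rewrite f_mor IH.
Qed.

Lemma cop_wins_in_bij k : cop_wins_in e2 k = cop_wins_in e1 k.
Proof.
rewrite /cop_wins_in exists_bij; apply: eq_existsb => c; rewrite forall_bij.
by apply: eq_forallb => r; apply: win_bij.
Qed.
End Isomorphism.

Lemma capture_time_iso (T1 T2 : finType) (e1 : rel T1) (e2 : rel T2) k :
  graph_iso e1 e2 -> capture_time e2 k -> capture_time e1 k.
Proof.
case=> f [fb fm] [wk Nk]; split; first by rewrite -(cop_wins_in_bij fb fm).
by move=> j /Nk; rewrite (cop_wins_in_bij fb fm).
Qed.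

Definition nat_core (f : nat -> nat -> bool) (l : seq nat) : seq nat :=
  [seq i <- l | ~~ adj_corner f l i].

Definition nat_stage f n j := iter j (nat_core f) (iota 0 n).

Definition nat_clique (f : nat -> nat -> bool) (l : seq nat) : bool := all (fun i => all (f i) l) l.

Definition nat_rank f n j0 : bool :=
  nat_clique f (nat_stage f n j0) &&
  all (fun j => ~~ nat_clique f (nat_stage f n j)) (iota 0 j0).

Definition nat_type1 f n j0 : bool :=
  has (fun i => all (f i) (nat_stage f n j0.-1)) (nat_stage f n j0).

Section NatGraph.
Variables (n : nat) (f : nat -> nat -> bool) (e : rel 'I_n.+1).
Hypothesis ef : forall i j : 'I_n.+1, e i j = f i j.

Lemma nat_stage_sub j : {subset nat_stage f n.+1 j <= iota 0 n.+1}.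
Proof. by elim: j => //= j IH i; rewrite mem_filter => /andP[_ /IH]. Qed.

Lemma nat_stage_lt j i : i \in nat_stage f n.+1 j -> i < n.+1.
Proof. by move/nat_stage_sub; rewrite mem_iota. Qed.

Lemma stage_nat j u : (u \in stage e j) = (val u \in nat_stage f n.+1 j).
Proof.
elim: j u => [|j IH] u; first by rewrite in_setT mem_iota add0n ltn_ord.
rewrite /= mem_filter in_setD IH.
case: (boolP (_ \in nat_stage _ _ _)) => uj; last by rewrite !andbF.
rewrite (@adj_cornerP _ e f inord (stage e j)) ?inord_val //.
- move=> v; rewrite IH; apply: (iffP idP) => [vj|[k kj ->]].
    by exists (val v); rewrite ?inord_val.
  by rewrite [val _]inordK ?(nat_stage_lt kj).
- by move=> i k /nat_stage_lt lti /nat_stage_lt ltk; rewrite ef !inordK.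
Qed.

Lemma all_nat_stage j (P : pred nat) :
  all P (nat_stage f n.+1 j) = [forall u in stage e j, P (val u)].
Proof.
apply/allP/forall_inP => H u; first by rewrite stage_nat => /H.
by move=> uj; have := H (inord u); rewrite stage_nat [val _]inordK ?(nat_stage_lt uj) //; apply.
Qed.

Lemma is_clique_nat j : is_clique e (stage e j) = nat_clique f (nat_stage f n.+1 j).
Proof.
rewrite /nat_clique all_nat_stage; apply: eq_forallb_in => u _.
by rewrite all_nat_stage; apply: eq_forallb_in => v _; apply: ef.
Qed.

Lemma type1_nat j0 : type1 e j0 = nat_type1 f n.+1 j0.
Proof.
rewrite /nat_type1 -[RHS]negbK -all_predC all_nat_stage negb_forall_in.
apply: eq_existsb => u /=; rewrite negbK all_nat_stage; congr (_ && _).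
by apply: eq_forallb => v; rewrite ef.
Qed.

Lemma corner_rank_nat j0 : nat_rank f n.+1 j0 -> corner_rank_pred e j0.
Proof.
case/andP=> cl /allP Ncl; split; first by rewrite is_clique_nat.
by move=> j lt; rewrite is_clique_nat; apply: Ncl; rewrite mem_iota.
Qed.
End NatGraph.

Lemma capture_time_nat n (f : nat -> nat -> bool) (e : rel 'I_n.+1) j0 :
  is_graph e -> (forall i j : 'I_n.+1, e i j = f i j) -> nat_rank f n.+1 j0.+1 ->
  capture_time e (j0.+2 - nat_type1 f n.+1 j0.+1).
Proof.
move=> [er es] ef rk; rewrite -(type1_nat ef).
exact: capture_time_rank er es _ ord0 (corner_rank_nat ef rk).
Qed.

(** * Paths, the graph H_7 and its extensions by a tail *)

Definition nat_path (i j : nat) : bool := (i <= j.+1) && (j <= i.+1).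

Definition nat_H7 (i j : nat) : bool :=
  [|| i == j, (i, j) \in H7_edges | (j, i) \in H7_edges].

(* In the labelling of [H7_edges], 4 and 5 are c1 and c2, and d = 6 precedes the
   first new vertex. *)
Definition tail_edge (i j : nat) : bool := (6 < j) && [|| i.+1 == j, i == 4 | i == 5].

(** One infinite graph, whose initial segments on [7 + k] vertices attain capture time [3 + k]. *)
Definition nat_H7plus (i j : nat) : bool :=
  [|| nat_H7 i j, tail_edge i j | tail_edge j i].

Lemma nat_H7_ge i j : 6 < i -> nat_H7 i j = (i == j).
Proof.
move=> lt; rewrite /nat_H7; case: eqP => //= _; apply/negbTE; apply/norP.
have ed : all (fun p => (p.1 < 7) && (p.2 < 7)) H7_edges by [].
by split; apply/negP => /(allP ed)/andP[/= l1 l2]; lia.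
Qed.

Lemma nat_H7_sym i j : nat_H7 i j = nat_H7 j i.
Proof. by rewrite /nat_H7 eq_sym [X in _ || X]orbC. Qed.

Lemma nat_H7plus_sym i j : nat_H7plus i j = nat_H7plus j i.
Proof. by rewrite /nat_H7plus nat_H7_sym [X in _ || X]orbC. Qed.

Lemma nat_H7plus_lt i j : i < 7 -> j < 7 -> nat_H7plus i j = nat_H7 i j.
Proof.
move=> li lj; rewrite /nat_H7plus /tail_edge.
by rewrite ![6 < _]ltnNge (ltnSE li) (ltnSE lj) !orbF.
Qed.

Lemma nat_H7plus_ge i j : 6 < j ->
  nat_H7plus i j = [|| i == j, i.+1 == j, i == j.+1, i == 4 | i == 5].
Proof.
move=> lt; rewrite /nat_H7plus nat_H7_sym nat_H7_ge // /tail_edge; lia.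
Qed.

Lemma not_adj_corner f l i :
  (forall w, w \in l -> w != i -> exists2 x, x \in l & f i x && ~~ f w x) ->
  ~~ adj_corner f l i.
Proof.
move=> H; apply/hasPn => w lw; case: eqVneq (H w lw) => [->|_] /= H'.
  by case: ifP => // _; apply/hasPn => k _; case: (f i k).
have [x lx /andP[ix Nwx]] := H' isT.
by case: allP => // /(_ x lx); rewrite ix (negbTE Nwx).
Qed.

(** The last vertex is cornered by the one before it, while every other vertex has, for each
    competitor [w], a neighbor that [w] misses. So the ranking takes the tail off one vertex at a
    time. *)
Lemma nat_core_H7plus m : 7 < m -> nat_core nat_H7plus (iota 0 m) = iota 0 m.-1.
Proof.
case: m => // m lt; have E : iota 0 m.+1 = iota 0 m ++ [:: m] by rewrite -addn1 iotaD.
rewrite /nat_core [X in filter _ X]E filter_cat [X in _ ++ X]/=.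
have -> : adj_corner nat_H7plus (iota 0 m.+1) m.
  apply/hasP; exists m.-1; first by rewrite mem_iota; lia.
  case: allP => [_|[]].
    (* The extra neighbor of [m.-1] is b1 if [m = 7], where [m.-1] is d, and [m.-2] otherwise. *)
    case: (eqVneq m 7) => [->|ne7]; first by vm_compute.
    apply/hasP; exists m.-2; first by rewrite mem_iota; lia.
    rewrite [nat_H7plus m.-1 _]nat_H7plus_sym [nat_H7plus m _]nat_H7plus_sym.
    by rewrite !nat_H7plus_ge; try case: ifP; lia.
  move=> k; rewrite mem_iota nat_H7plus_sym nat_H7plus_ge // nat_H7plus_sym.
  case: ifP => // adj_m lt_k; case: (eqVneq m 7) lt_k adj_m => [->|ne7] lt_k adj_m.
    have : k \in [:: 4; 5; 6; 7] by rewrite !inE; lia.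
    by clear lt_k adj_m; move: k; apply/allP.
  by rewrite nat_H7plus_ge; lia.
rewrite cats0 -[RHS]filter_predT; apply: eq_in_filter => i.
rewrite mem_iota add0n => lti; apply: not_adj_corner => w.
rewrite mem_iota => /= ltw wi.
have ex x : x < m.+1 -> nat_H7plus i x && ~~ nat_H7plus w x ->
    exists2 x, x \in iota 0 m.+1 & nat_H7plus i x && ~~ nat_H7plus w x.
  by move=> ltx H; exists x; rewrite ?mem_iota.
(* For [i] on the tail: c1 and c2 miss each other, [i.-1] and [i.+1] miss each other, and any other
   [w] misses [i] itself. *)
case: (ltnP 6 i) => [gti|lei].
  have nbi x : nat_H7plus i x = [|| x == i, x.+1 == i, x == i.+1, x == 4 | x == 5].
    by rewrite nat_H7plus_sym nat_H7plus_ge.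
  have nbw x : 6 < x -> nat_H7plus w x = [|| w == x, w.+1 == x, w == x.+1, w == 4 | w == 5].
    exact: nat_H7plus_ge.
  case: (eqVneq w 4) => [w4|w4]; first by apply: (ex 5); [lia|rewrite nbi w4 /= !orbT].
  case: (eqVneq w 5) => [w5|w5]; first by apply: (ex 4); [lia|rewrite nbi w5 /= !orbT].
  case: (eqVneq w i.-1) => [wE|w3].
    by apply: (ex i.+1); rewrite ?nbi ?nbw; lia.
  case: (eqVneq w i.+1) => [wE|w2]; last by apply: (ex i); rewrite ?nbi ?nbw; lia.
  apply: (ex i.-1); rewrite ?nbi; first by lia.
  by rewrite nat_H7plus_sym nat_H7plus_ge; lia.
(* A tail vertex misses a1, a2, b1 and b2; the list names a neighbor of [i] among these. *)
case: (ltnP 6 w) => [gtw|lew].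
  pose x := nth 0 [:: 0; 1; 2; 3; 1; 0; 2] i.
  have chk : all (fun i => let x := nth 0 [:: 0; 1; 2; 3; 1; 0; 2] i in
     [&& x < 4 & nat_H7 i x]) (iota 0 7) by vm_compute.
  have /andP[ltx ix] : (x < 4) && nat_H7 i x by apply: (allP chk); rewrite mem_iota.
  apply: (ex x); first lia.
  rewrite nat_H7plus_lt ?ix /=; [|lia|lia].
  by rewrite nat_H7plus_sym nat_H7plus_ge //; lia.
(* The only strict corner of H_7 is d, cornered by b1 alone, and the first tail vertex is adjacent
   to d but not to b1. *)
case: (boolP ((i == 6) && (w == 2))) => [/andP[/eqP iE /eqP wE]|Niw].
  by apply: (ex 7); [lia|rewrite iE wE].
have chk : all (fun i => all (fun w => [|| i == w, (i == 6) && (w == 2) |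
     has (fun x => nat_H7 i x && ~~ nat_H7 w x) (iota 0 7)]) (iota 0 7)) (iota 0 7).
  by vm_compute.
have mem7 k : k <= 6 -> k \in iota 0 7 by rewrite mem_iota.
have /allP/(_ w (mem7 w lew)) := allP chk i (mem7 i lei).
rewrite (negbTE Niw) eq_sym (negbTE wi) => /hasP[x]; rewrite mem_iota => /= ltx H.
by apply: (ex x); rewrite ?nat_H7plus_lt //; lia.
Qed.

Lemma nat_stage_H7plus m j : 6 < m -> nat_stage nat_H7plus (m + j) j = iota 0 m.
Proof.
move=> lt; rewrite /nat_stage; elim: j => [|j IH]; first by rewrite addn0.
by rewrite addnS iterSr nat_core_H7plus ?IH //; lia.
Qed.

Lemma nat_stage_H7plus_top k i :
  nat_stage nat_H7plus (7 + k) (i + k) = nat_stage nat_H7plus 7 i.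
Proof. by rewrite /nat_stage iterD -/(nat_stage _ _ k) nat_stage_H7plus. Qed.

Lemma nat_rank_H7plus k : nat_rank nat_H7plus (7 + k) (3 + k).
Proof.
apply/andP; split; first by rewrite nat_stage_H7plus_top; vm_compute.
apply/allP => j; rewrite mem_iota => /= lt; case: (leqP k j) => jk.
  rewrite -(subnK jk) nat_stage_H7plus_top.
  have : j - k < 3 by lia.
  by case: (j - k) => [|[|[|]]] // _; vm_compute.
have -> : 7 + k = (7 + (k - j)) + j by lia.
by rewrite nat_stage_H7plus.
Qed.

Lemma nat_type1_H7plus k : nat_type1 nat_H7plus (7 + k) (3 + k).
Proof.
by rewrite /nat_type1 nat_stage_H7plus_top -[(3 + k).-1]/(2 + k) nat_stage_H7plus_top; vm_compute.
Qed.

Definition H7plus_rel k : rel 'I_(7 + k) := fun i j => nat_H7plus i j.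

Lemma H7plus_graph k : is_graph (@H7plus_rel k).
Proof.
split=> [x|x y]; last exact: nat_H7plus_sym.
by rewrite /H7plus_rel /nat_H7plus /nat_H7 eqxx.
Qed.

Lemma capture_time_H7plus k : capture_time (@H7plus_rel k) (3 + k).
Proof.
have := @capture_time_nat (6 + k) nat_H7plus (@H7plus_rel k) (2 + k) (H7plus_graph k).
by rewrite nat_type1_H7plus subn1; apply; rewrite ?nat_rank_H7plus.
Qed.

Lemma path_graph n : is_graph (path_rel n).
Proof. by split=> [x|x y]; rewrite /path_rel ?leqnSn // andbC. Qed.

Lemma H7_graph : is_graph H7_rel.
Proof.
split=> [x|x y]; rewrite /H7_rel ?eqxx // eq_sym; congr (_ || _); exact: orbC.
Qed.

Lemma capture_time_H7 : capture_time H7_rel 3.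
Proof.
have := @capture_time_nat 6 nat_H7 H7_rel 2 H7_graph (fun _ _ => erefl).
have -> : nat_type1 nat_H7 7 3 by vm_compute.
by apply; vm_compute.
Qed.

Lemma capture_time_path n : n < 6 ->
  capture_time (path_rel n.+3) (n.+3)./2.
Proof.
move=> lt; have H m : nat_rank nat_path n.+3 m.+1 ->
    (n.+3)./2 = m.+2 - nat_type1 nat_path n.+3 m.+1 -> capture_time (path_rel n.+3) (n.+3)./2.
  by move=> rk ->; apply: capture_time_nat rk => //; apply: path_graph.
(* Each round deletes the two ends of the path, which makes [n./2.+1] rounds. *)
by apply: (H n./2); move: lt {H}; case: n => [|[|[|[|[|[|]]]]]] // _; vm_compute.
Qed.

(** * Realizable vectors of small excess *)

(** Beginnings, paired with a type, that satisfy the bounds on single entries and have excess at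
    most 3 in type 1 or 4 in type 0, but occur in no graph. *)
Definition unrealizable : seq (bool * seq nat) :=
  [:: (true, [:: 1; 2; 2; 1]); (true, [:: 1; 2; 3; 1]); (true, [:: 1; 3; 2; 1]);
      (true, [:: 1; 2; 2; 2; 1]);
      (false, [:: 2; 2; 2; 1]); (false, [:: 2; 2; 3; 1]); (false, [:: 2; 3; 2; 1]);
      (false, [:: 3; 2; 2; 1]); (false, [:: 2; 2; 2; 2; 1])].

Lemma unrealizable_nil : all (fun tv => nilp (realizations tv.1 tv.2)) unrealizable.
Proof. by vm_compute. Qed.

(* Two vertices of the same rank are the next two ends of a path. *)
Definition flank (ps : seq (seq nat)) (x : nat) : seq (seq nat) :=
  flatten [seq [:: x :: rcons p x.+1; x.+1 :: rcons p x] | p <- ps].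

(** The vertices come by decreasing rank: the middle is 0 or the pair 0, 1, and each lower rank is a
    pair [x], [x.+1] whose two placements are both tried. *)
Definition path_orders (n : nat) : seq (seq nat) :=
  foldl flank [:: iota 0 (if odd n then 1 else 2)]
    [seq (if odd n then i.*2.+1 else i.*2.+2) | i <- iota 0 (n.-1./2)].

(** An isomorphism preserves ranks, so only vertices of equal rank are exchanged. *)
Definition H7_orders : seq (seq nat) :=
  [seq ab ++ c ++ [:: 6] |
     ab <- [seq a ++ b | a <- [:: [:: 0; 1]; [:: 1; 0]], b <- [:: [:: 2; 3]; [:: 3; 2]]],
     c <- [:: [:: 4; 5]; [:: 5; 4]]].

Definition all_isomorphic f t v ps :=
  all (fun g => has (isomorphic_via f (sumn v) g) ps) (realizations t v).

(** The odd paths P_3, P_5, P_7 have type 1 and one top vertex, the even paths P_4, P_6, P_8 have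
    type 0 and two. *)
Lemma all_path :
  all (fun tv => all_isomorphic nat_path tv.1 tv.2 (path_orders (sumn tv.2)))
    [:: (true, [:: 1; 2]); (true, [:: 1; 2; 2]); (true, [:: 1; 2; 2; 2]);
        (false, [:: 2; 2]); (false, [:: 2; 2; 2]); (false, [:: 2; 2; 2; 2])].
Proof. by vm_compute. Qed.

Lemma all_H7 : all_isomorphic nat_H7 true [:: 2; 2; 2; 1] H7_orders.
Proof. by vm_compute. Qed.

(** * Necessary conditions on a rank cardinality vector *)

Section Realization.
Variables (T : finType) (e : rel T) (j0 : nat).
Hypotheses (eG : is_graph e) (rk : corner_rank_pred e j0) (x0 : T).

Lemma prefix_realizable k : k <= j0 ->
  (type1 e j0, take k.+1 (rcv e j0)) \notin unrealizable.
Proof.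
case: eG => er es kj; apply/negP => /(allP unrealizable_nil)/nilP nil.
have {}nil : realizations (type1 e j0) (take k.+1 (rcv e j0)) = [::] := nil.
by have [s [_ _]] := realizations_complete x0 er es rk kj; rewrite nil.
Qed.

Lemma graph_iso_realization n (f : nat -> nat -> bool) (e2 : rel 'I_n) ps :
  #|T| = n -> (forall i j : 'I_n, e2 i j = f i j) ->
  all_isomorphic f (type1 e j0) (rcv e j0) ps -> graph_iso e e2.
Proof.
case: eG => er es cT e2f /allP H.
have [s [us sT]] := realizations_complete x0 er es rk (leqnn j0).
rewrite take_oversize ?size_rcv // => /H/hasP[p _]; rewrite sumn_rcv cT => Hp.
apply: (@graph_iso_enc _ _ x0 er es _ _ f _ p us _ cT e2f Hp).
by move=> u; rewrite sT subnn.
Qed.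
End Realization.

(** With these conditions the classification becomes arithmetic on lists; entries 0, 1 and 2 belong
    to the three highest ranks. *)
Definition admissible (t : bool) (v : seq nat) : Prop :=
  [/\ 1 < size v, all (leq 1) v, 1 < nth 0 v 1, 2 < size v -> 1 < nth 0 v 2
    & (~~ t -> 1 < nth 0 v 0) /\
      forall k, 0 < k <= size v -> (t, take k v) \notin unrealizable].

Lemma rcv_admissible (T : finType) (e : rel T) j0 : T -> is_graph e ->
  corner_rank_pred e j0.+1 -> admissible (type1 e j0.+1) (rcv e j0.+1).
Proof.
move=> x0 eG rk; have [er es] := eG; have [cl Ncl] := rk.
have pos := rcv_gt0 x0 rk; split=> //; first by rewrite size_rcv.
- have -> : nth 0 (rcv e j0.+1) 1 = #|corners e (stage e j0)|.
    by rewrite nth_rcv // subSS subn0.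
  have := corners_neq0 rk (ltnSn j0); rewrite -card_gt0.
  by case: #|_| (two_corners er es cl (Ncl j0 (ltnSn j0))) => [|[|]].
- rewrite size_rcv; case: j0 cl Ncl rk {pos} => // j cl Ncl rk _.
  have -> : nth 0 (rcv e j.+2) 2 = #|corners e (stage e j)|.
    by rewrite nth_rcv // !subSS subn0.
  have := corners_neq0 rk (leqnSn j.+1); rewrite -card_gt0.
  by case: #|_| (two_corners_below er es cl (Ncl j.+1 (ltnSn _))) => [|[|]].
split; first by apply: (@top_gt1 _ _ er j0 x0).
by case=> // k; rewrite size_rcv => /= kj; apply: prefix_realizable.
Qed.

Lemma leq_size_sumn r : all (leq 1) r -> size r <= sumn r.
Proof. by elim: r => //= x r IH /andP[x0 /IH]; lia. Qed.

Lemma all_ones r : all (leq 1) r -> sumn r <= size r -> r = nseq (size r) 1.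
Proof.
elim: r => //= x r IH /andP[x0 r1]; have := leq_size_sumn r1 => le sr.
by rewrite -IH //; [congr (_ :: _)|]; lia.
Qed.

(* The excess [sumn v - size v] is the number of vertices minus the corner rank. *)
Lemma admissible1_long v : admissible true v -> 3 < size v -> sumn v <= size v + 3 ->
  v = [:: 1; 2; 2; 2] \/ exists k, v = [:: 2; 2; 2] ++ nseq k.+1 1.
Proof.
case: v => [|a [|b [|c [|d r]]]] // [_ pos b2 c2 [_ unr]] _ /=.
move: pos b2 c2 => /= /and5P[a0 _ _ d0 r1] b2 /(_ isT) c2 le.
have sr := leq_size_sumn r1.
have P4 : (true, [:: a; b; c; d]) \notin unrealizable.
  by have := unr 4 isT; rewrite /= take0.
have P5 x r' : r = x :: r' -> (true, [:: a; b; c; d; x]) \notin unrealizable.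
  by move=> E; have := unr 5; rewrite E /= take0; apply.
(* Since [b] and [c] use at least 2 of the excess 3, at most 1 is left for everything else. *)
have abc : [|| (a, b, c) == (1, 2, 2), (a, b, c) == (2, 2, 2),
   (a, b, c) == (1, 2, 3) | (a, b, c) == (1, 3, 2)] by rewrite !xpair_eqE; lia.
case/or4P: abc => /eqP[? ? ?]; subst a b c.
- have d12 : d = 1 \/ d = 2 by lia.
  case: d12 => ?; subst d => //; left.
  case: r r1 sr le P5 {unr} => [//|x r] /= /andP[x0 r1] sr le P5.
  have x1 : x = 1 by have := leq_size_sumn r1; lia.
  by have := P5 x r erefl; rewrite x1.
- right; exists (size r); have d1 : d = 1 by lia.
  by rewrite d1 /= -all_ones //; lia.
- have d1 : d = 1 by lia.
  by rewrite d1 in P4.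
- have d1 : d = 1 by lia.
  by rewrite d1 in P4.
Qed.

Lemma admissible1_short v : admissible true v -> size v <= 3 -> sumn v <= size v + 2 ->
  v \in [:: [:: 1; 2]; [:: 2; 2]; [:: 1; 3]; [:: 1; 2; 2]].
Proof.
case: v => [|a [|b [|c [|d r]]]] [] //= _ pos b2 c2 _ _ le.
  have : [|| (a, b) == (1, 2), (a, b) == (2, 2) | (a, b) == (1, 3)].
    by rewrite !xpair_eqE; lia.
  by case/or3P=> /eqP[-> ->].
have := c2 isT; have -> : a = 1 by lia.
have -> : b = 2 by lia.
by have -> : c = 2 by lia.
Qed.

(** With three or more ranks the first three entries already use 3 of the excess 4, and a fourth or
    fifth entry 1 completes an excluded beginning. *)
Lemma admissible0 v : admissible false v -> sumn v <= size v + 4 ->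
  v \in [:: [:: 2; 2]; [:: 2; 3]; [:: 3; 2]; [:: 2; 4]; [:: 3; 3]; [:: 4; 2];
     [:: 2; 2; 2]; [:: 2; 2; 3]; [:: 2; 3; 2]; [:: 3; 2; 2]; [:: 2; 2; 2; 2]].
Proof.
case: v => [|a [|b r]] [] //= _ /and3P[_ _ r1] b2 c2 [/(_ isT) a2 unr] le.
have sr := leq_size_sumn r1.
case: r r1 sr c2 unr le => [|c r] /= r1 sr c2 unr le.
  have : [|| (a, b) == (2, 2), (a, b) == (2, 3), (a, b) == (3, 2), (a, b) == (2, 4) |
     ((a, b) == (3, 3)) || ((a, b) == (4, 2))] by rewrite !xpair_eqE; lia.
  by case/or4P=> [||| /orP[|/orP[]]] /eqP[-> ->].
have {}c2 := c2 isT; have {}r1 : all (leq 1) r by case/andP: r1.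
have {}sr := leq_size_sumn r1.
have : [|| (a, b, c) == (2, 2, 2), (a, b, c) == (2, 2, 3), (a, b, c) == (2, 3, 2) |
     (a, b, c) == (3, 2, 2)] by rewrite !xpair_eqE; lia.
case: r r1 sr unr le => [|d r] /=; first by move=> _ _ _ _ /or4P[] /eqP[-> -> ->].
move=> /andP[d0 r1] sr unr le; have {}sr := leq_size_sumn r1.
have P4 : (false, [:: a; b; c; d]) \notin unrealizable by have := unr 4 isT; rewrite /= take0.
case/or4P=> /eqP[? ? ?]; subst a b c; 
  try by have d1 : d = 1; [lia|rewrite d1 in P4].
have d12 : d = 1 \/ d = 2 by lia.
case: d12 => ?; subst d => //.
case: r r1 sr le unr => [//|x r] /= /andP[x0 r1] sr le unr.
have x1 : x = 1 by have := leq_size_sumn r1; lia.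
by have := unr 5 isT; rewrite x1 /= take0.
Qed.

(** * CT-maximal graphs *)

Lemma capt_is_uniq n m m' : capt_is n m -> capt_is n m' -> m = m'.
Proof.
case=> [[T [e [eG cT et]]] le] [[T' [e' [eG' cT' et']]] le']; apply/eqP.
by rewrite eqn_leq (le' _ _ _ eG cT et) (le _ _ _ eG' cT' et').
Qed.

(** Allowing all [k] with [m <= k] in the second hypothesis yields the upper bound on capture times
    and the description of the extremal graphs at once. *)
Lemma CT_maximal_char n m (P : forall T : finType, rel T -> Prop) :
  (exists (T : finType) (e : rel T), [/\ is_graph e, #|T| = n & capture_time e m]) ->
  (forall (T : finType) (e : rel T) k, is_graph e -> #|T| = n -> capture_time e k ->
     m <= k -> k = m /\ P T e) ->
  (forall (T : finType) (e : rel T), is_graph e -> #|T| = n -> P T e -> capture_time e m) ->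
  capt_is n m /\ forall (T : finType) (e : rel T), is_graph e -> #|T| = n ->
    (CT_maximal e <-> P T e).
Proof.
move=> ex max cap; have cm : capt_is n m.
  split=> // T e k eG cT ek; rewrite leqNgt; apply/negP => mk.
  by have [km _] := max T e k eG cT ek (ltnW mk); rewrite km ltnn in mk.
split=> // T e eG cT; split=> [[m' [cm' em']]|Pe].
  rewrite cT in cm'; rewrite -(capt_is_uniq cm cm') in em'.
  by have [] := max T e m eG cT em' (leqnn m).
by exists m; rewrite cT; split=> //; apply: cap.
Qed.

Lemma inhabited_card (T : finType) n : #|T| = n -> 0 < n -> T.
Proof. by move=> <- /card_gt0P/sigW[]. Qed.

Lemma capture_time_all (T : finType) (e : rel T) : (forall x y, e x y) -> 0 < #|T| ->
  capture_time e (1 < #|T|).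
Proof.
move=> ea T0; have x0 := inhabited_card erefl T0.
apply: capture_time_clique => // [x y|]; first by rewrite !ea.
by split=> //; apply/is_cliqueP.
Qed.

Lemma capture_time_vector (T : finType) (e : rel T) n k :
  is_graph e -> #|T| = n -> 0 < n -> capture_time e k ->
  (corner_rank_pred e 0 /\ k = (1 < n)) \/
  exists j0, [/\ corner_rank_pred e j0.+1, admissible (type1 e j0.+1) (rcv e j0.+1),
    sumn (rcv e j0.+1) = n & k = size (rcv e j0.+1) - type1 e j0.+1].
Proof.
move=> eG cT n0 ek; have x0 := inhabited_card cT n0; have [er es] := eG.
have cw : cop_win e by exists k; case: ek.
have [[|j0] rk] := cop_win_rank er es cw; [left|right; exists j0].
  split=> //; apply: capture_time_uniq ek _; rewrite -cT.
  exact: capture_time_clique.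
rewrite sumn_rcv size_rcv; split=> //; first exact: rcv_admissible.
by apply: capture_time_uniq ek _; apply: capture_time_rank.
Qed.

Lemma clique_iso (T : finType) (e : rel T) n (e2 : rel 'I_n) :
  is_graph e -> #|T| = n -> 0 < n < 4 -> corner_rank_pred e 0 ->
  (forall i j, e2 i j) -> graph_iso e e2.
Proof.
move=> eG cT /andP[n0 n4] rk e2a; have x0 := inhabited_card cT n0.
apply: (@graph_iso_realization T e 0 eG rk x0 n (fun _ _ => true) e2 [:: iota 0 n]) => //.
rewrite /rcv /= cardsT cT; move: n0 n4 {cT e2 e2a}.
by case: n => [|[|[|[|]]]] // _ _; vm_compute.
Qed.

Lemma path_iso (T : finType) (e : rel T) n j0 t v : is_graph e -> #|T| = n ->
  corner_rank_pred e j0 -> 0 < n -> type1 e j0 = t -> rcv e j0 = v ->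
  (t, v) \in [:: (true, [:: 1; 2]); (true, [:: 1; 2; 2]); (true, [:: 1; 2; 2; 2]);
        (false, [:: 2; 2]); (false, [:: 2; 2; 2]); (false, [:: 2; 2; 2; 2])] ->
  graph_iso e (path_rel n).
Proof.
move=> eG cT rk n0 tE vE /(allP all_path) H; have x0 := inhabited_card cT n0.
by apply: (graph_iso_realization eG rk x0 cT (f := nat_path)); rewrite ?tE ?vE //; apply: H.
Qed.

Lemma capture_time_rank_graph (T : finType) (e : rel T) j0 : is_graph e -> 0 < #|T| ->
  corner_rank_pred e j0.+1 -> capture_time e (j0.+2 - type1 e j0.+1).
Proof.
by move=> [er es] T0; apply: capture_time_rank => //; apply: (inhabited_card erefl T0).
Qed.

Lemma realizes0_capture_time (T : finType) (e : rel T) v : is_graph e -> 0 < #|T| ->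
  realizes0 e v -> capture_time e (size v).
Proof.
move=> eG T0 [[|j0] [rk -> // _ /negbTE t0]]; rewrite size_rcv.
by have := capture_time_rank_graph eG T0 rk; rewrite t0 subn0.
Qed.

(** The beginning (2,2,2,1) is excluded in type 0, so the vector forces type 1. *)
Lemma in_H7plus_capture_time (T : finType) (e : rel T) k : is_graph e ->
  in_H7plus_k k e -> #|T| = 7 + k /\ capture_time e (3 + k).
Proof.
move=> eG [j0 [rk E]]; have cT := sumn_rcv e j0.
have sz := size_rcv e j0; rewrite -E in cT sz.
have {}cT : #|T| = 7 + k by rewrite -cT /= sumn_nseq; lia.
have T0 : 0 < #|T| by rewrite cT.
have j0E : j0 = k.+3 by move: sz; rewrite /= size_nseq; lia.
split=> //; subst j0; have := capture_time_rank_graph eG T0 rk.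
have := prefix_realizable eG rk (inhabited_card erefl T0) (k := 3).
by rewrite -E /= take0; case: (type1 _ _) => [_|/(_ isT)//]; rewrite subn1.
Qed.

(* CT-maximality forces excess at most 4 for type 0 and at most 3 for type 1. *)
Lemma large_extremal (T : finType) (e : rel T) n k :
  is_graph e -> #|T| = n -> 6 < n -> capture_time e k -> n - 4 <= k ->
  k = n - 4 /\
  [\/ in_H7plus_k (n - 7) e,
      n = 7 /\ graph_iso e (path_rel 7),
      n = 8 /\ graph_iso e (path_rel 8) |
      n = 7 /\ [\/ realizes0 e [:: 2; 2; 3], realizes0 e [:: 2; 3; 2] |
                   realizes0 e [:: 3; 2; 2]]].
Proof.
move=> eG cT n7 ek nk; have n0 : 0 < n by lia.
have [[_ kE]|[j0 [rk adm sE kE]]] := capture_time_vector eG cT n0 ek.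
  by move: nk; rewrite kE; case: (1 < n) => /=; lia.
case t1 : (type1 e j0.+1) adm kE => adm kE.
  (* In type 1 the length is [k + 1], hence at least [n - 3], which exceeds 3. *)
  have [|//|E|[i E]] := admissible1_long adm; rewrite ?sE; try lia.
    have n7E : n = 7 by rewrite -sE E.
    split; first by rewrite kE E n7E.
    by apply: Or42; split=> //; move: cT; rewrite n7E => cT; apply: path_iso eG cT rk _ t1 E _.
  have iE : i = n - 7 by rewrite -sE E /= sumn_nseq; lia.
  split; first by rewrite kE E /= size_nseq; lia.
  by apply: Or41; exists j0.+1; rewrite -iE -E.
have {}kE : k = size (rcv e j0.+1) by rewrite kE subn0.
have r0 : realizes0 e (rcv e j0.+1) by exists j0.+1; rewrite t1.
have /(admissible0 adm) : sumn (rcv e j0.+1) <= size (rcv e j0.+1) + 4 by rewrite sE; lia.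
(* Vectors of sum at most 6 contradict [6 < n]; three of sum 7 and (2,2,2,2) remain. *)
rewrite !inE => vs; move: sE r0 kE cT.
repeat match type of vs with is_true (orb _ _) => case/orP: vs => [/eqP E|vs] end;
  rewrite ?(eqP vs) ?E /=; move=> sE r0 kE cT; try lia;
  (split; first lia).
- by apply: Or44; split; [lia|apply: Or31].
- by apply: Or44; split; [lia|apply: Or32].
- by apply: Or44; split; [lia|apply: Or33].
have n8 : n = 8 by lia.
apply: Or43; split=> //; apply: path_iso eG _ rk _ t1 (eqP vs) _ => //.
by rewrite cT n8.
Qed.

Lemma nonclique_extremal (T : finType) (e : rel T) n k m :
  is_graph e -> #|T| = n -> 1 < n < 7 -> m = n./2 -> capture_time e k -> m <= k ->
  k = m /\ [\/ graph_iso e (path_rel n), corner_rank_pred e 0 /\ n <= 3 |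
      n = 5 /\ (realizes0 e [:: 2; 3] \/ realizes0 e [:: 3; 2])].
Proof.
move=> eG cT n17 mE ek mk; have n0 : 0 < n by lia.
have [[rk kE]|[j0 [rk adm sE kE]]] := capture_time_vector eG cT n0 ek.
  by split; [|apply: Or32; split=> //]; move: mk; rewrite kE; case: (1 < n) (n17) => /=; lia.
(* This is the bound [n./2 <= k] without the halving. *)
have n_le : n <= k + k.+1 by lia.
case t1 : (type1 e j0.+1) adm kE => adm kE.
  (* In type 1, four or more ranks would require at least 7 vertices. *)
  case: (leqP (size (rcv e j0.+1)) 3) => sz; last first.
    by have [|//|E|[i E]] := admissible1_long adm; rewrite ?sE; try lia;
       exfalso; rewrite E /= ?sumn_nseq ?size_nseq in sE kE sz; lia.
  have /(admissible1_short adm sz) : sumn (rcv e j0.+1) <= size (rcv e j0.+1) + 2.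
    by rewrite sE; lia.
  rewrite !inE => vs.
  (* The vectors (2,2) and (1,3) have 4 vertices but capture time 1 in type 1. *)
  have {}vs : rcv e j0.+1 = [:: 1; 2] \/ rcv e j0.+1 = [:: 1; 2; 2].
    by case/or4P: vs => /eqP E; rewrite E; [left| | |right] => //; exfalso;
      rewrite E /= in sE kE; lia.
  case: vs => E; rewrite E /= in sE kE; split; try lia; apply: Or31;
    by apply: path_iso eG cT rk n0 t1 E _.
have r0 : realizes0 e (rcv e j0.+1) by exists j0.+1; rewrite t1.
have /(admissible0 adm) : sumn (rcv e j0.+1) <= size (rcv e j0.+1) + 4 by rewrite sE; lia.
rewrite !inE => vs.
(* Vectors of sum 7 or more are too large, and two entries of sum 6 give capture time 2 instead of
   3. *)
repeat match type of vs with is_true (orb _ _) => case/orP: vs => [/eqP E|vs] end;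
  try (move/eqP: vs => E); rewrite E /= in sE kE r0; split; try lia.
all: try by apply: Or31; apply: path_iso eG cT rk n0 t1 E _.
- by apply: Or33; split; [lia|left].
- by apply: Or33; split; [lia|right].
Qed.

(** The capture time stands in for the list of extremal graphs, which differs between 7, 8 and
    larger [n]. *)
Lemma capt_large n : 7 <= n ->  capt_is n (n - 4) /\ 
  forall (T : finType) (e : rel T), is_graph e -> #|T| = n ->
    (CT_maximal e <-> capture_time e (n - 4)).
Proof.
move=> n7; apply: (@CT_maximal_char n (n - 4) (fun T e => capture_time e (n - 4))) => //.
  have cT := capture_time_H7plus (n - 7); have nE : 7 + (n - 7) = n by lia.
  exists 'I_(7 + (n - 7)), (@H7plus_rel (n - 7)); split; [exact: H7plus_graph|by rewrite card_ord|].
  by have -> : n - 4 = 3 + (n - 7) by lia.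
move=> T e k eG cT ek nk; have [kE _] := large_extremal eG cT n7 ek nk.
by rewrite -kE.
Qed.

Lemma capture_time_path_lt9 n : 0 < n < 9 -> capture_time (path_rel n) n./2.
Proof.
case: n => [|[|[|n]]] //= n9; last exact: (@capture_time_path n).
  by have := @capture_time_all _ (path_rel 1); rewrite card_ord; apply=> // -[[]] // ? [[]].
by have := @capture_time_all _ (path_rel 2); rewrite card_ord; apply=> // -[[|[]]] // ? [[|[]]].
Qed.

Lemma path_witness n : 0 < n < 9 ->
  exists (T : finType) (e : rel T), [/\ is_graph e, #|T| = n & capture_time e n./2].
Proof.
move=> n9; exists 'I_n, (path_rel n); rewrite card_ord; split=> //; first exact: path_graph.
exact: capture_time_path_lt9.
Qed.

Lemma path_extremal (T : finType) (e : rel T) n : 0 < n < 9 ->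
  graph_iso e (path_rel n) -> capture_time e n./2.
Proof. by move=> n9 iso; apply: capture_time_iso iso (capture_time_path_lt9 n9). Qed.

Theorem theorem4p3 :
  (forall n, 7 <= n -> capt_is n (n - 4)) /\
  (forall n (T : finType) (e : rel T), 9 <= n -> is_graph e -> #|T| = n ->
     cop_win e -> (CT_maximal e <-> in_H7plus e)) /\
  (capt_is 1 0 /\ forall (T : finType) (e : rel T), is_graph e -> #|T| = 1 ->
     (CT_maximal e <-> graph_iso e (path_rel 1))) /\
  (capt_is 2 1 /\ forall (T : finType) (e : rel T), is_graph e -> #|T| = 2 ->
     (CT_maximal e <-> graph_iso e (path_rel 2))) /\
  (capt_is 3 1 /\ forall (T : finType) (e : rel T), is_graph e -> #|T| = 3 ->
     (CT_maximal e <-> graph_iso e (path_rel 3) \/ graph_iso e K3_rel)) /\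
  (capt_is 4 2 /\ forall (T : finType) (e : rel T), is_graph e -> #|T| = 4 ->
     (CT_maximal e <-> graph_iso e (path_rel 4))) /\
  (capt_is 5 2 /\ forall (T : finType) (e : rel T), is_graph e -> #|T| = 5 ->
     (CT_maximal e <-> [\/ graph_iso e (path_rel 5),
                           realizes0 e [:: 2; 3] | realizes0 e [:: 3; 2]])) /\
  (capt_is 6 3 /\ forall (T : finType) (e : rel T), is_graph e -> #|T| = 6 ->
     (CT_maximal e <-> graph_iso e (path_rel 6))) /\
  (capt_is 7 3 /\ forall (T : finType) (e : rel T), is_graph e -> #|T| = 7 ->
     (CT_maximal e <-> graph_iso e (path_rel 7) \/ graph_iso e H7_rel \/
                         realizes0 e [:: 2; 2; 3] \/ realizes0 e [:: 2; 3; 2] \/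
                         realizes0 e [:: 3; 2; 2])) /\
  (capt_is 8 4 /\ forall (T : finType) (e : rel T), is_graph e -> #|T| = 8 ->
     (CT_maximal e <-> graph_iso e (path_rel 8) \/ in_H7plus_k 1 e)).
Proof.
(* The orders 2 to 6 share the path as witness and the same three alternatives. *)
have small n m (P : forall T : finType, rel T -> Prop) : 1 < n < 7 -> m = n./2 ->
    (forall (T : finType) (e : rel T), is_graph e -> #|T| = n ->
      [\/ graph_iso e (path_rel n), corner_rank_pred e 0 /\ n <= 3 |
        n = 5 /\ (realizes0 e [:: 2; 3] \/ realizes0 e [:: 3; 2])] -> P T e) ->
    (forall (T : finType) (e : rel T), is_graph e -> #|T| = n -> P T e ->
      capture_time e m) ->
    capt_is n m /\ forall (T : finType) (e : rel T), is_graph e -> #|T| = n ->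
      (CT_maximal e <-> P T e).
  move=> n17 mE nec suf; apply: CT_maximal_char => //.
    by rewrite mE; apply: path_witness; lia.
  move=> T e k eG cT ek mk.
  by have [-> H] := nonclique_extremal eG cT n17 mE ek mk; split=> //; apply: nec.
split; first by move=> n /capt_large[].
split.
  move=> n T e n9 eG cT _; have n7 : 7 <= n by lia.
  rewrite ((capt_large n7).2 T e eG cT); split=> [ek|[k Hk]].
    have [_ [H|[E]|[E]|[E]]] := large_extremal eG cT n7 ek (leqnn _); try lia.
    by exists (n - 7).
  have [cTk] := in_H7plus_capture_time eG Hk.
  by rewrite (_ : 3 + k = n - 4) //; lia.
split.
  (* A single vertex is a clique, since a vector with two positive entries has sum at least 2. *)
  apply: (@CT_maximal_char 1 0 (fun T e => graph_iso e (path_rel 1))).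
  - exact: (@path_witness 1).
  - move=> T e k eG cT ek _.
    have [[rk ->]|[j0 [rk [sz pos _ _ _] sE _]]] := capture_time_vector eG cT isT ek.
      by split=> //; apply: clique_iso eG cT _ rk _ => // -[[]] // ? [[]].
    by have := leq_size_sumn pos; rewrite sE; lia.
  - by move=> T e _ _; apply: (@path_extremal _ _ 1).
split.
  apply: (small 2 1 (fun T e => graph_iso e (path_rel 2))) => // [T e eG cT|T e _ _].
    case=> [//|[rk _]|[]//].
    by apply: clique_iso eG cT _ rk _ => // -[[|[]]] // ? [[|[]]].
  exact: (@path_extremal _ _ 2).
split.
  apply: (small 3 1 (fun T e => graph_iso e (path_rel 3) \/ graph_iso e K3_rel)) => //.
    move=> T e eG cT [|[rk _]|[]//]; first by left.
    by right; apply: clique_iso eG cT _ rk _.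
  move=> T e _ _ [|iso]; first exact: (@path_extremal _ _ 3).
  apply: capture_time_iso iso _.
  by have := @capture_time_all _ K3_rel; rewrite card_ord; apply.
split.
  apply: (small 4 2 (fun T e => graph_iso e (path_rel 4))) => // [T e eG cT|T e _ _].
    by case=> [//|[]|[]].
  exact: (@path_extremal _ _ 4).
split.
  apply: (small 5 2 (fun T e => [\/ graph_iso e (path_rel 5),
                           realizes0 e [:: 2; 3] | realizes0 e [:: 3; 2]])) => //.
    move=> T e eG cT [|[]//|[_ [|]]];
      [by apply: Or31|by apply: Or32|by apply: Or33].
  move=> T e eG cT [| |]; first exact: (@path_extremal _ _ 5).
    by apply: realizes0_capture_time; rewrite // cT.
  by apply: realizes0_capture_time; rewrite // cT.
split.
  apply: (small 6 3 (fun T e => graph_iso e (path_rel 6))) => // [T e eG cT|T e _ _].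
    by case=> [//|[]|[]].
  exact: (@path_extremal _ _ 6).
have [c7 m7] := @capt_large 7 isT; have [c8 m8] := @capt_large 8 isT.
split.
  split=> // T e eG cT; rewrite (m7 T e eG cT); split=> [ek|].
    have [_ [H|[_ H]|[]//|[_ H]]] := large_extremal eG cT isT ek isT.
    (* Here the vector is (2,2,2,1), which occurs only in type 1, and there only for H_7. *)
    - right; left; case: H => j0 [rk E]; have x0 := inhabited_card cT isT.
      have := prefix_realizable eG rk x0 (leqnn j0); rewrite take_oversize ?size_rcv // -E.
      case t1: (type1 e j0) => // _; apply: (graph_iso_realization eG rk x0 cT (f := nat_H7)) => //.
      by rewrite t1 -E; apply: all_H7.
    - by left.
    - by case: H => H; do ?[by left|right].
  case=> [|[|H]]; first exact: (@path_extremal _ _ 7).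
    by move=> iso; apply: capture_time_iso iso capture_time_H7.
  by case: H => [|[|]]; apply: realizes0_capture_time; rewrite // cT.
split=> // T e eG cT; rewrite (m8 T e eG cT); split=> [ek|].
  by have [_ [H|[]//|[_ H]|[]//]] := large_extremal eG cT isT ek isT; [right|left].
case; first exact: (@path_extremal _ _ 8).
by case/(in_H7plus_capture_time eG).
Qed.
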